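(* Let $S$ be a right-reversible monoid and suppose that flat $S$-acts are closed under stable Rees extensions. Then every act in $\mathrm{Act}\text{-}S$ has an $\mathcal{F}$-cover, where $\mathcal{F}$ is the class of flat $S$-acts (i.e. the Flat Cover Conjecture holds in $\mathrm{Act}\text{-}S$). If, in addition, $S$ has a left zero, then the Flat Cover Conjecture holds in $\mathrm{Act}_0\text{-}S$, i.e. every act in $\mathrm{Act}_0\text{-}S$ has, in the category $\mathrm{Act}_0\text{-}S$, a cover with respect to the class of flat acts in $\mathrm{Act}_0\text{-}S$.
   Context: A monoid $S$ is right-reversible if any two (nonempty) left ideals of $S$ intersect. An element $z\in S$ is a left zero if $zs=z$ for all $s\in S$. A (right) $S$-act is a nonempty set $A$ with a map $A\times S\to A$ such that $(as)t=a(st)$ and $a1=a$; homomorphisms satisfy $\varphi(as)=\varphi(a)s$. $\mathrm{Act}\text{-}S$ is the category of these. If $S$ has a left zero, $\mathrm{Act}_0\text{-}S$ is the full subcategory of acts having a unique fixed point. For a subact $A$ of $B$, the Rees quotient $B/A$ is the quotient of $B$ by the congruence identifying $b_0,b_1$ iff $b_0=b_1$ or both lie in $A$. A right $S$-act $F$ is flat if $F\otimes_S -$ sends monomorphisms of left $S$-acts to injective maps. A monomorphism $f:X\to Y$ of right $S$-acts is stable if for every homomorphism $\lambda:A\to B$ of left $S$-acts, $\operatorname{im}(f\otimes\mathrm{id}_B)\cap\operatorname{im}(\mathrm{id}_Y\otimes\lambda)\subseteq\operatorname{im}(f\otimes\lambda)$ (inside $Y\otimes_S B$); a subact is stable if its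 inclusion is. Flat $S$-acts are closed under stable Rees extensions if: whenever $A$ is a (nonempty) stable subact of an $S$-act $B$, and $A$ and $B/A$ are flat, then $B$ is flat. For a class $\mathcal{X}$ of acts and an act $A$, an $\mathcal{X}$-precover of $A$ is a morphism $\pi:X\to A$ with $X\in\mathcal{X}$ such that every morphism $X'\to A$ with $X'\in\mathcal{X}$ factors (not necessarily uniquely) through $\pi$. It is an $\mathcal{X}$-cover if moreover every $j:X\to X$ with $\pi\circ j=\pi$ is an automorphism of $X$. *)

(* Defs.v *)
From HB Require Import structures.
From Stdlib Require Import Relation_Operators.
From mathcomp Require Import all_boot.
From mathcomp Require Import boolp classical_sets.

Set Implicit Arguments.
Unset Strict Implicit.
Unset Printing Implicit Defensive.

Local Open Scope classical_set_scope.
Local Open Scope quotient_scope.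

(* A monoid is a MathComp [monoidType].  Its [choiceType] part is no restriction:
   every type carries one by [boolp.gen_choiceMixin]. *)

Section GeneratedQuotient.
Variables (T : Type) (r : T -> T -> Prop).

Definition gen_equiv : rel {classic T} :=
  fun x y => `[< clos_refl_sym_trans T r x y >].

Lemma gen_equiv_refl : reflexive gen_equiv.
Proof. by move=> x; apply/asboolP; apply: rst_refl. Qed.

Lemma gen_equiv_sym : symmetric gen_equiv.
Proof. by move=> x y; apply/asboolP/asboolP => h; apply: rst_sym. Qed.

Lemma gen_equiv_trans : transitive gen_equiv.
Proof.
by move=> y x z /asboolP h /asboolP k; apply/asboolP; apply: rst_trans h k.
Qed.

Canonical gen_equiv_equiv :=
  EquivRel gen_equiv gen_equiv_refl gen_equiv_sym gen_equiv_trans.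

Definition gen_quot : Type := {eq_quot gen_equiv}.

Definition gen_pi (x : T) : gen_quot := \pi_({eq_quot gen_equiv}) x.
Definition gen_repr (q : gen_quot) : T := repr (q : {eq_quot gen_equiv}).

Lemma gen_piP x y : gen_pi x = gen_pi y <-> clos_refl_sym_trans T r x y.
Proof.
split=> [/eqP|h]; first by rewrite /gen_pi eqmodE => /asboolP.
by apply/eqP; rewrite /gen_pi eqmodE; apply/asboolP.
Qed.

Lemma gen_reprK q : gen_pi (gen_repr q) = q.
Proof. exact: reprK. Qed.

End GeneratedQuotient.

Section QuotientMap.
Variables (T U : Type) (r : T -> T -> Prop) (r' : U -> U -> Prop) (f : T -> U).

Definition gen_map (q : gen_quot r) : gen_quot r' := gen_pi r' (f (gen_repr q)).

Lemma gen_mapE : (forall x y, r x y -> clos_refl_sym_trans U r' (f x) (f y)) ->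
  forall x, gen_map (gen_pi r x) = gen_pi r' (f x).
Proof.
move=> fr x; apply/gen_piP.
have : clos_refl_sym_trans T r (gen_repr (gen_pi r x)) x.
  by apply/gen_piP; rewrite gen_reprK.
move: (gen_repr _) => y; elim=> [? ? /fr //|?|? ? _ h|? ? ? _ h _ k].
- exact: rst_refl.
- exact: rst_sym.
- exact: rst_trans h k.
Qed.

End QuotientMap.

Record rightAct (S : monoidType) := RightAct {
  ract_sort :> Type;
  ract : ract_sort -> S -> ract_sort;
  ractM : forall a s t, ract (ract a s) t = ract a (s * t)%g;
  ract1 : forall a, ract a 1%g = a;
  ract_inhabited : inhabited ract_sort }.

Record leftAct (S : monoidType) := LeftAct {
  lact_sort :> Type;
  lact : S -> lact_sort -> lact_sort;
  lactM : forall s t b, lact s (lact t b) = lact (s * t)%g b;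
  lact1 : forall b, lact 1%g b = b;
  lact_inhabited : inhabited lact_sort }.

Record rhom (S : monoidType) (A B : rightAct S) := RHom {
  rhom_fun :> A -> B;
  rhomP : forall a s, rhom_fun (ract a s) = ract (rhom_fun a) s }.

Record lhom (S : monoidType) (A B : leftAct S) := LHom {
  lhom_fun :> A -> B;
  lhomP : forall s a, lhom_fun (lact s a) = lact s (lhom_fun a) }.

Definition rmono (S : monoidType) (X Y : rightAct S) (f : rhom X Y) : Prop :=
  forall (Z : rightAct S) (g h : rhom Z X), f \o g =1 f \o h -> g =1 h.

Definition lmono (S : monoidType) (X Y : leftAct S) (f : lhom X Y) : Prop :=
  forall (Z : leftAct S) (g h : lhom Z X), f \o g =1 f \o h -> g =1 h.

Section Regular.
Variable S : monoidType.

Definition rreg : rightAct S :=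
  @RightAct S S (fun a s => a * s)%g (fun a s t => esym (mulgA a s t))
    (@mulg1 S) (inhabits 1%g).

Definition lreg : leftAct S :=
  @LeftAct S S (fun s a => s * a)%g (fun s t b => mulgA s t b)
    (@mul1g S) (inhabits 1%g).

Definition rorbit (A : rightAct S) (a : A) : rhom rreg A :=
  @RHom S rreg A (ract a) (fun s t => esym (ractM a s t)).

Definition lorbit (B : leftAct S) (b : B) : lhom lreg B :=
  @LHom S lreg B (fun s => lact s b) (fun s t => esym (lactM s t b)).

Lemma rmonoP (X Y : rightAct S) (f : rhom X Y) : rmono f <-> injective f.
Proof.
split=> [fm x y fxy|fi Z g h fgh z]; last exact/fi/fgh.
rewrite -(ract1 x) -(ract1 y).
apply: (fm _ (rorbit x) (rorbit y) _ 1%g) => s /=.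
by rewrite !rhomP fxy.
Qed.

Lemma lmonoP (X Y : leftAct S) (f : lhom X Y) : lmono f <-> injective f.
Proof.
split=> [fm x y fxy|fi Z g h fgh z]; last exact/fi/fgh.
rewrite -(lact1 x) -(lact1 y).
apply: (fm _ (lorbit x) (lorbit y) _ 1%g) => s /=.
by rewrite !lhomP fxy.
Qed.

End Regular.

Definition rhom_id (S : monoidType) (A : rightAct S) : rhom A A :=
  @RHom S A A id (fun _ _ => erefl).

Definition lhom_id (S : monoidType) (B : leftAct S) : lhom B B :=
  @LHom S B B id (fun _ _ => erefl).

Section Tensor.
Variable S : monoidType.

Inductive tensor_step (A : rightAct S) (B : leftAct S) :
    A * B -> A * B -> Prop :=
  TensorStep (a : A) (s : S) (b : B) :
    tensor_step (ract a s, b) (a, lact s b).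

Definition tensor (A : rightAct S) (B : leftAct S) : Type :=
  gen_quot (@tensor_step A B).

Definition tens (A : rightAct S) (B : leftAct S) (a : A) (b : B) : tensor A B :=
  gen_pi (@tensor_step A B) (a, b).

(* [gen_map] goes through representatives; [tensor_mapE] is the defining
   equation. *)
Definition tensor_map (A A' : rightAct S) (B B' : leftAct S)
    (f : rhom A A') (g : lhom B B') : tensor A B -> tensor A' B' :=
  gen_map (@tensor_step A' B') (fun p => (f p.1, g p.2)).

Lemma tensor_mapE (A A' : rightAct S) (B B' : leftAct S)
    (f : rhom A A') (g : lhom B B') (a : A) (b : B) :
  tensor_map f g (tens a b) = tens (f a) (g b).
Proof.
apply: gen_mapE => _ _ [{}a s {}b] /=; apply: rst_step.
by rewrite rhomP lhomP; exact: TensorStep.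
Qed.

Definition flat (F : rightAct S) : Prop :=
  forall (A B : leftAct S) (f : lhom A B),
    lmono f -> injective (tensor_map (rhom_id F) f).

Definition stable (X Y : rightAct S) (f : rhom X Y) : Prop :=
  rmono f /\
  forall (A B : leftAct S) (lambda : lhom A B),
    range (tensor_map f (lhom_id B)) `&` range (tensor_map (rhom_id Y) lambda)
      `<=` range (tensor_map f lambda).

End Tensor.

Record subact (S : monoidType) (B : rightAct S) := Subact {
  subact_set :> set B;
  subact_neq0 : subact_set !=set0;
  subactP : forall a s, subact_set a -> subact_set (ract a s) }.

Section SubactAct.
Variables (S : monoidType) (B : rightAct S) (A : subact B).

Definition sub_ract (a : set_type A) (s : S) : set_type A :=
  exist _ (ract (val a) s) (mem_set (subactP s (set_mem (valP a)))).

Lemma sub_ractM a s t : sub_ract (sub_ract a s) t = sub_ract a (s * t)%g.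
Proof. by apply: val_inj; rewrite /= ractM. Qed.

Lemma sub_ract1 a : sub_ract a 1%g = a.
Proof. by apply: val_inj; rewrite /= ract1. Qed.

Lemma sub_inhabited : inhabited (set_type A).
Proof. by case: (subact_neq0 A) => a Aa; exists; exists a; apply: mem_set. Qed.

Definition act_of_subact : rightAct S :=
  RightAct sub_ractM sub_ract1 sub_inhabited.

Definition inclusion : rhom act_of_subact B :=
  @RHom S act_of_subact B val (fun _ _ => erefl).

Definition rees_rel (b0 b1 : B) : Prop :=
  b0 = b1 \/ (subact_set A b0 /\ subact_set A b1).

Lemma rees_relP b0 b1 :
  gen_pi rees_rel b0 = gen_pi rees_rel b1 <-> rees_rel b0 b1.
Proof.
rewrite gen_piP; split=> [|?]; last exact: rst_step.
elim=> // [x|x y _|x y z _ h _ k]; first by left.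
- by case=> [->|[]]; [left|right].
- case: h k => [->//|[Ax Ay]] [<-|[_ Az]]; by right.
Qed.

Definition rees_ract (q : gen_quot rees_rel) (s : S) : gen_quot rees_rel :=
  gen_map rees_rel (fun b => ract b s) q.

Lemma rees_ractE b s : rees_ract (gen_pi rees_rel b) s = gen_pi rees_rel (ract b s).
Proof.
apply: (gen_mapE (f := fun b => ract b s)) => x y h; apply: rst_step.
by case: h => [->|[Ax Ay]]; [left|right; split; apply: subactP].
Qed.

Lemma rees_ractM q s t : rees_ract (rees_ract q s) t = rees_ract q (s * t)%g.
Proof. by rewrite -(gen_reprK q) !rees_ractE ractM. Qed.

Lemma rees_ract1 q : rees_ract q 1%g = q.
Proof. by rewrite -(gen_reprK q) rees_ractE ract1. Qed.

Lemma rees_inhabited : inhabited (gen_quot rees_rel).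
Proof. by case: (ract_inhabited B) => b; exists; exact: gen_pi b. Qed.

Definition rees_quotient : rightAct S :=
  RightAct rees_ractM rees_ract1 rees_inhabited.

End SubactAct.

Definition flat_closed_under_stable_rees_extensions (S : monoidType) : Prop :=
  forall (B : rightAct S) (A : subact B),
    stable (inclusion A) -> flat (act_of_subact A) -> flat (rees_quotient A) ->
    flat B.

Section Monoids.
Variable S : monoidType.

Definition left_ideal (I : set S) : Prop := forall s x, I x -> I (s * x)%g.

Definition right_reversible : Prop :=
  forall I J : set S, left_ideal I -> left_ideal J ->
    I !=set0 -> J !=set0 -> I `&` J !=set0.

Definition is_left_zero (z : S) : Prop := forall s, (z * s)%g = z.

End Monoids.

Definition fixed_point (S : monoidType) (A : rightAct S) (a : A) : Prop :=
  forall s, ract a s = a.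

(* the objects of the full subcategory Act_0-S *)
Definition in_act0 (S : monoidType) (A : rightAct S) : Prop :=
  exists! a : A, fixed_point a.

Section Covers.
Variables (S : monoidType) (C : rightAct S -> Prop).

Definition is_precover (X A : rightAct S) (p : rhom X A) : Prop :=
  C X /\ forall (X' : rightAct S) (g : rhom X' A), C X' ->
    exists h : rhom X' X, p \o h =1 g.

Definition automorphism (X : rightAct S) (j : rhom X X) : Prop :=
  exists k : rhom X X, cancel j k /\ cancel k j.

Definition is_cover (X A : rightAct S) (p : rhom X A) : Prop :=
  is_precover p /\
  forall j : rhom X X, p \o j =1 p -> automorphism j.

Definition has_cover (A : rightAct S) : Prop :=
  exists (X : rightAct S) (p : rhom X A), is_cover p.

End Covers.

(* [K] selects the objects of a full subcategory of Act-S.  Fullness makes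
   (pre)covers in that subcategory the same as (pre)covers in Act-S with respect
   to the flat acts satisfying [K]. *)
Definition flat_cover_conjecture (S : monoidType) (K : rightAct S -> Prop) :
    Prop :=
  forall A : rightAct S, K A -> has_cover (fun F => K F /\ flat F) A.

(* Main.v *)
Require Import Defs.
From Stdlib Require Import Relation_Operators.
From mathcomp Require Import all_boot.
From mathcomp Require Import boolp classical_sets wochoice.

(** A flat cover is obtained from a flat precover, and a flat precover from
    a small object argument in which flat acts are built by gluing small flat
    acts along stable subsets.

    Gluing.  Let [Z] be obtained from a flat act [Y] by gluing a flat act [D]
    along a stable subset [C] of [D].  A zigzag in [Z] that passes from [Y] to
    the rest of [D] has to cross [C] ([crossing]), so stability of [C] in [D]
    gives stability of [Y] in [Z].  The Rees quotient of [Z] by [Y] is [D] with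
    [C] collapsed to a point, and collapsing a stable subset preserves flatness
    ([collapse_flat]): this uses that the one-point act is flat, which is what
    right-reversibility means.  Closure under stable Rees extensions then makes
    [Z] flat ([glue_flat]).

    Smallness.  Equality in a tensor product is witnessed by a finite zigzag
    whose shape is a word over the monoid.  Closing an element of a flat act [F]
    under the action and under chosen solutions of zigzags gives a subact [E]
    of [F] that is flat and stable, and in which the trace of a given stable set
    [C] is stable.  Its elements are named by terms over the monoid, so up to
    isomorphism there is only a set of such pieces.  Stable sets are closed
    under union, so [C] together with [E] is stable again: a flat act is
    exhausted by successive gluings of small flat acts.

    Precovers.  Over an act [A], all small cells are glued in all possible ways,
    transfinitely often; the result is a type of well-founded trees ([tree]).
    The complex of valid trees is flat, as a maximal suitable flat subact is
    everything ([complex_flat]), and every flat act over [A] maps to it, by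
    extending partial lifts with stable domain one small piece at a time
    ([flat_lift]).  If the monoid has a left zero [z], the points [x z] are
    fixed, and the fixed points of an act form a stable subact; collapsing those
    of a flat precover gives a precover among the acts with a unique fixed
    point ([act0_precover]).

    Covers.  Both classes are closed under filtered colimits.  Hence every
    transfinite chain of endomorphisms over [A] of a precover [P] has a cocone
    with vertex [P].  A chain that kept identifying new elements of its first
    stage would be longer than the size of [P] allows, so some endomorphism [f]
    has a kernel that no further endomorphism enlarges ([stable_kernel]).  The
    colimit of the iterates of [f] is a precover all of whose endomorphisms over
    [A] are injective ([precover_mono_endo]), and a second chain argument shows
    that they are then surjective ([mono_endo_cover]). *)

Set Implicit Arguments.
Unset Strict Implicit.
Unset Printing Implicit Defensive.

Local Open Scope classical_set_scope.

(** * Tensor products by finite zigzags *)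

Definition rhom_comp (S : monoidType) (X Y Z : rightAct S)
    (g : rhom Y Z) (f : rhom X Y) : rhom X Z :=
  @RHom S X Z (g \o f)
    (fun x s => etrans (congr1 g (rhomP f x s)) (rhomP g (f x) s)).

Definition sub_elt (S : monoidType) (X : rightAct S) (C : subact X) x
    (Cx : subact_set C x) : act_of_subact C := exist _ x (mem_set Cx).

Lemma sub_eltP (S : monoidType) (X : rightAct S) (C : subact X)
  (x : act_of_subact C) : subact_set C (val x).
Proof. exact: set_mem (valP x). Qed.

Section SubIncl.
Variables (S : monoidType) (X : rightAct S) (C D : subact X).
Hypothesis CD : subact_set C `<=` subact_set D.

Lemma sub_incl_ract (x : act_of_subact C) s :
  sub_elt (CD (sub_eltP (ract x s))) = ract (sub_elt (CD (sub_eltP x))) s.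
Proof. exact: val_inj. Qed.

Definition sub_incl : rhom (act_of_subact C) (act_of_subact D) :=
  @RHom S (act_of_subact C) (act_of_subact D)
    (fun x => sub_elt (CD (sub_eltP x))) sub_incl_ract.

End SubIncl.

Section TensorProduct.
Variable S : monoidType.
Implicit Types (F X Y Z : rightAct S) (A B : leftAct S).

Lemma tens_surj X B (t : tensor X B) : exists x b, t = tens x b.
Proof. by rewrite -(gen_reprK t); case: (gen_repr t) => x b; exists x, b. Qed.

Lemma tens_act X B (x : X) s (b : B) : tens (ract x s) b = tens x (lact s b).
Proof. by apply/gen_piP; apply: rst_step; exact: TensorStep. Qed.

Lemma tens_hom X Y A B (f : rhom X Y) (g : lhom A B) x a x' a' :
  tens x a = tens x' a' -> tens (f x) (g a) = tens (f x') (g a').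
Proof. by move=> /(congr1 (tensor_map f g)); rewrite !tensor_mapE. Qed.

(** A property of pairs that the defining moves preserve in both directions is
    a property of tensors; equalities of tensors are analysed by choosing such
    a property. *)
Lemma tens_invariant X B (P : X -> B -> Prop) :
    (forall x s b, P (ract x s) b <-> P x (lact s b)) ->
  forall x b x' b', tens x b = tens x' b' -> P x b -> P x' b'.
Proof.
move=> Pinv x b x' b' /gen_piP h.
suff : P x b <-> P x' b' by case.
rewrite -[P x b]/(P (x, b).1 (x, b).2) -[P x' b']/(P (x', b').1 (x', b').2).
elim: h => [_ _ [a s c]|p|p q _|p q r _ h _ k] //=.
- by case; split.
- by rewrite h.
Qed.

Lemma flat_tens F : flat F ->
  forall A B (f : lhom A B), injective f ->
  forall (x : F) a x' a', tens x (f a) = tens x' (f a') -> tens x a = tens x' a'.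
Proof.
move=> Fflat A B f /lmonoP /Fflat fi x a x' a' e; apply: fi.
by rewrite !tensor_mapE.
Qed.

Lemma tens_flat F :
    (forall A B (f : lhom A B), injective f ->
     forall (x : F) a x' a', tens x (f a) = tens x' (f a') -> tens x a = tens x' a') ->
  flat F.
Proof.
move=> h A B f /lmonoP fi t t'.
have [x [a ->]] := tens_surj t; have [x' [a' ->]] := tens_surj t'.
by rewrite !tensor_mapE; exact: h.
Qed.

Lemma rreg_flat : flat (rreg S).
Proof.
apply: tens_flat => A B f fi x a x' a'.
move/(tens_invariant (P := fun (y : rreg S) b => lact x (f a) = lact y b)).
rewrite -!lhomP => h; have {}h : lact x a = lact x' a'.
  by apply/fi/h => // y s b; rewrite lactM.
have E (y : rreg S) (b : A) : tens y b = tens (1%g : rreg S) (lact y b).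
  by rewrite -tens_act /= mul1g.
by rewrite E h -E.
Qed.

(** A word records the shape of a zigzag: the letter [(true, s)] replaces
    [(a s, b)] by [(a, s b)], and [(false, s)] does the converse.  Words form a
    set that depends on the monoid alone, which is what bounds the size of the
    pieces of a flat act. *)
Definition word := seq (bool * S).

Fixpoint zigR X (x : X) (w : word) (y : X) : Prop :=
  match w with
  | [::] => x = y
  | (true, s) :: v => exists2 a, ract a s = x & zigR a v y
  | (false, s) :: v => zigR (ract x s) v y
  end.

Fixpoint zigL B (b : B) (w : word) (b' : B) : Prop :=
  match w with
  | [::] => b = b'
  | (true, s) :: v => zigL (lact s b) v b'
  | (false, s) :: v => exists2 c, lact s c = b & zigL c v b'
  end.

Lemma zig_tens X B w (x y : X) (b b' : B) :
  zigR x w y -> zigL b w b' -> tens x b = tens y b'.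
Proof.
elim: w x b => [|[[] s] w IH] x b /=; first by move=> -> ->.
- by case=> a <- r l; rewrite tens_act; exact: IH.
- by move=> r [c <- l]; rewrite -tens_act; exact: IH.
Qed.

Lemma tens_zig X B (x y : X) (b b' : B) :
  tens x b = tens y b' -> exists2 w, zigR x w y & zigL b w b'.
Proof.
move/esym => e.
pose P z c := exists2 w, zigR z w y & zigL c w b'.
apply: (tens_invariant (P := P) _ e); last by exists [::].
move=> a s c; split=> -[w r l].
- by exists ((false, s) :: w) => //=; exists c.
- by exists ((true, s) :: w) => //=; exists a.
Qed.

End TensorProduct.

(** * Filtered colimits of flat acts *)

Section Filtered.
Variable S : monoidType.
Implicit Types (X Y : rightAct S).

(** The transition maps are not part of the data: it is enough that maps over
    [X] between the stages exist where they are needed, and no coherence between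
    them is required. *)
Definition filtered_colimit X (I : Type) (Xi : I -> rightAct S)
    (c : forall i, rhom (Xi i) X) : Prop :=
  [/\ forall x, exists i y, c i y = x,
      forall i j, exists k (g : rhom (Xi i) (Xi k)) (h : rhom (Xi j) (Xi k)),
        c k \o g =1 c i /\ c k \o h =1 c j &
      forall i j x y, c i x = c j y ->
        exists k (g : rhom (Xi i) (Xi k)) (h : rhom (Xi j) (Xi k)),
          [/\ c k \o g =1 c i, c k \o h =1 c j & g x = h y]].

(** A zigzag lifts move by move to later and later stages: the element of [X]
    that two consecutive moves share has two liftings, which become equal
    further on. *)
Lemma filtered_tens X I (Xi : I -> rightAct S) (c : forall i, rhom (Xi i) X) :
  filtered_colimit c -> forall (B : leftAct S) i j x (b : B) y b',
  tens (c i x) b = tens (c j y) b' ->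
  exists k (g : rhom (Xi i) (Xi k)) (h : rhom (Xi j) (Xi k)),
    [/\ c k \o g =1 c i, c k \o h =1 c j & tens (g x) b = tens (h y) b'].
Proof.
move=> [csurj _ cfilt] B i j x b y b' e.
pose P w e := forall l z, c l z = w ->
  exists k (g : rhom (Xi i) (Xi k)) (h : rhom (Xi l) (Xi k)),
    [/\ c k \o g =1 c i, c k \o h =1 c l & tens (g x) b = tens (h z) e].
apply: (tens_invariant (P := P) _ e) => // [w s {}e|l z /esym/cfilt]; last first.
  by case=> k [g [h [cg ch gh]]]; exists k, g, h; rewrite gh.
split=> Pw l z czw.
- have [|k [g [h [cg ch E]]]] := Pw l (ract z s); first by rewrite rhomP czw.
  by exists k, g, h; split=> //; rewrite E rhomP tens_act.
- have [m [u cu]] := csurj w.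
  have [k [g [h [cg ch E]]]] := Pw _ _ cu.
  have [|n [p [q [cp cq pq]]]] := cfilt k l (h (ract u s)) z.
    by rewrite -[c k _]/((c k \o h) _) ch rhomP cu.
  exists n.
  exists (rhom_comp p g), q; split=> //.
    by move=> a /=; rewrite -[c n _]/((c n \o p) _) cp -cg.
  move/(tens_hom p (lhom_id B)): E => /= ->.
  by rewrite -tens_act -rhomP -rhomP pq.
Qed.

Lemma filtered_flat X I (Xi : I -> rightAct S) (c : forall i, rhom (Xi i) X) :
  filtered_colimit c -> (forall i, flat (Xi i)) -> flat X.
Proof.
move=> cf Xflat; apply: tens_flat => A B f fi x a x' a'.
have [csurj _ _] := cf.
have [i [y <-]] := csurj x; have [j [y' <-]] := csurj x'.
move=> /(filtered_tens cf) [k [g [h [cg ch /(flat_tens (Xflat k) fi) E]]]].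
rewrite -cg -ch /=.
exact: (tens_hom (c k) (lhom_id A) E).
Qed.

(** An isomorphism is a filtered colimit with one stage. *)
Lemma flat_iso X Y (f : rhom X Y) :
  injective f -> (forall y, exists x, f x = y) -> flat X -> flat Y.
Proof.
move=> fi fs Xflat.
apply: (filtered_flat (I := unit) (Xi := fun=> X) (c := fun=> f)) => //.
split=> [y|_ _|_ _ x y /fi ->]; first by have [x] := fs y; exists tt, x.
all: by exists tt, (rhom_id X), (rhom_id X).
Qed.

End Filtered.

(** * Stability, and gluing along a stable subset *)

Section Stability.
Variable S : monoidType.
Implicit Types (F X Y Z D : rightAct S) (A B : leftAct S).

(** Stability of a set of elements; unlike for subacts, the empty set is
    admitted, so that an act can be built up from nothing. *)
Definition stable_set X (C : set X) : Prop :=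
  forall A B (f : lhom A B) (c : X) b x a, C c -> tens c b = tens x (f a) ->
    exists c' a', C c' /\ tens c b = tens c' (f a').

Lemma stable_inclusion X (C : subact X) :
  stable_set (subact_set C) -> stable (inclusion C).
Proof.
move=> Cst; split; first by apply/rmonoP; exact: val_inj.
move=> A B f t [[u _ uE] [v _ vE]].
have [c [b uE']] := tens_surj u; have [x [a vE']] := tens_surj v.
move: uE vE; rewrite uE' vE' !tensor_mapE /= => <- /esym E.
have [|c' [a' [Cc' ->]]] := Cst _ _ f _ _ _ _ _ E.
  exact: sub_eltP.
by exists (tens (sub_elt Cc') a') => //;
  rewrite tensor_mapE.
Qed.

Lemma stable_setU X (C D : set X) :
  stable_set C -> stable_set D -> stable_set (C `|` D).
Proof.
move=> Cst Dst A B f c b x a [Cc|Dc] e.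
- by have [c' [a' [? ->]]] := Cst _ _ _ _ _ _ _ Cc e; exists c', a'; split=> //; left.
- by have [c' [a' [? ->]]] := Dst _ _ _ _ _ _ _ Dc e; exists c', a'; split=> //; right.
Qed.

Section Crossing.
Variables (D Z : rightAct S) (phi : rhom D Z) (V : set Z) (C : set D).
Hypothesis VP : forall z s, V z -> V (ract z s).
Hypothesis CV : forall d, C d <-> V (phi d).
Hypothesis phi_inj : forall d d', ~ C d -> phi d = phi d' -> d = d'.
Hypothesis cover : forall z, V z \/ exists d, phi d = z.

(** When [Z] is obtained by gluing [D] to [V] along [C], a zigzag in [Z]
    starting in [D] can be followed inside [D] until it meets [C]. *)
Lemma crossing B d (b : B) z b' : ~ C d -> tens (phi d) b = tens z b' ->
  (exists d', [/\ ~ C d', phi d' = z & tens d b = tens d' b']) \/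
  (exists c b1, C c /\ tens d b = tens c b1).
Proof.
move=> nCd e; have [|nmeet] := pselect (exists c b1, C c /\ tens d b = tens c b1).
  by right.
left; pose P z b' := exists d', [/\ ~ C d', phi d' = z & tens d b = tens d' b'].
apply: (tens_invariant (P := P) _ e); last by exists d.
move=> {z b' e} z s b'; split=> -[d' [nCd' dz db]].
- case: (cover z) => [Vz|[d2 d2z]].
    by case: nCd'; apply/CV; rewrite dz; exact: VP.
  have E : d' = ract d2 s by apply: phi_inj => //; rewrite dz rhomP d2z.
  exists d2; split=> //; last by rewrite db E tens_act.
  by rewrite CV d2z => /VP -/(_ s); rewrite -dz -CV.
- exists (ract d' s); split; rewrite ?rhomP ?dz ?tens_act //.
  by move=> Cds; apply: nmeet; exists (ract d' s), b'; rewrite tens_act.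
Qed.

End Crossing.

(** Having a common multiple is transitive over a right-reversible monoid, and
    is then equality in the tensor product with the one-point act; this is why
    that act is flat. *)
Definition connected B (b b' : B) := exists s t, lact s b = lact t b'.

Lemma tens_connected X B (x x' : X) (b b' : B) :
  right_reversible S -> tens x b = tens x' b' -> connected b b'.
Proof.
move=> rev e; apply: (tens_invariant (P := fun=> connected b) _ e); last first.
  by exists 1%g, 1%g.
move=> _ s c; split=> -[p [q pq]]; last first.
  by exists p, (q * s)%g; rewrite pq lactM.
pose ideal (r : S) := [set u | exists v, u = (v * r)%g].
have idealP r : left_ideal (ideal r).
  by move=> u _ [v ->]; exists (u * v)%g; rewrite mulgA.
have ideal0 r : ideal r !=set0 by exists r, 1%g; rewrite mul1g.
have [_ [[u ->] [v E]]] := rev _ _ (idealP q) (idealP s) (ideal0 q) (ideal0 s).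
by exists (u * p)%g, v; rewrite -lactM pq lactM E -lactM.
Qed.

(** Collapsing a stable set [C] of a flat act to a point [o], which is added if
    [C] is empty.  By the crossing lemma an equality in [Q (x) B] either holds
    in [D (x) B], or both its sides reach [o]; in the second case stability
    makes them reach [o] over the smaller left act, where reversibility
    compares them. *)
Lemma collapse_flat D Q (phi : rhom D Q) (C : set D) (o : Q) :
  right_reversible S -> flat D -> stable_set C -> fixed_point o ->
  (forall d, C d <-> phi d = o) ->
  (forall d d', ~ C d -> phi d = phi d' -> d = d') ->
  (forall q, q = o \/ exists d, phi d = q) ->
  flat Q.
Proof.
move=> rev Dflat Cst oP Co phi_inj cover.
apply: tens_flat => A B f fi.
have absorb r (c : A) : tens o (lact r c) = tens o c by rewrite -tens_act oP.
(* each side either already equals its value at [o] over the smaller left act,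
   or lies in [D] and does not meet [C] over the larger one *)
have null q a : (tens q a = tens o a) \/
    exists d, [/\ phi d = q, ~ C d & ~ exists c b1, C c /\ tens d (f a) = tens c b1].
  case: (cover q) => [->|[d dq]]; first by left.
  have [Cd|nCd] := pselect (C d); first by left; rewrite -dq (Co d).1.
  have [[c [b1 [Cc E]]]|] := pselect (exists c b1, C c /\ tens d (f a) = tens c b1).
    left; have [c' [a' [Cc']]] := Cst _ _ _ _ _ _ _ Cc (esym E).
    rewrite -E => /(flat_tens Dflat fi) E'.
    have [s [t st]] := tens_connected rev E'.
    move/(tens_hom phi (lhom_id A)): E' => /=.
    rewrite dq (Co c').1 // => ->.
    by rewrite -(absorb t) -st absorb.
  by move=> nmeet; right; exists d.
have VP z s : [set o] z -> [set o] (ract z s) by move=> ->; exact: oP.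
have direct q a q' a' d : phi d = q -> ~ C d ->
    ~ (exists c b1, C c /\ tens d (f a) = tens c b1) ->
    tens q (f a) = tens q' (f a') -> tens q a = tens q' a'.
  move=> <- nCd nmeet /(crossing VP Co phi_inj cover nCd) [|//].
  move=> [d' [_ <- /(flat_tens Dflat fi) E]].
  exact: (tens_hom phi (lhom_id A) E).
move=> q a q' a' e.
case: (null q a) => [E|[d [dq nCd nmeet]]]; last exact: direct dq nCd nmeet e.
case: (null q' a') => [E'|[d [dq nCd nmeet]]]; last first.
  exact/esym/(direct _ _ _ _ _ dq nCd nmeet)/esym.
rewrite E E'; have [s [t]] := tens_connected rev e.
rewrite -!lhomP => /fi st.
by rewrite -(absorb s) st absorb.
Qed.

Definition rees_pi X (C : subact X) : rhom X (rees_quotient C) :=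
  @RHom S X (rees_quotient C) (gen_pi (rees_rel C))
    (fun x s => esym (rees_ractE C x s)).

Lemma rees_flat X (C : subact X) :
  right_reversible S -> flat X -> stable_set (subact_set C) ->
  flat (rees_quotient C).
Proof.
move=> rev Xflat Cst; have [c Cc] := subact_neq0 C.
apply: (@collapse_flat X _ (rees_pi C) (subact_set C) (rees_pi C c)) => //.
- move=> s; rewrite /= rees_ractE; apply/rees_relP.
  by right; split=> //; exact: subactP.
- move=> x /=; split; first by move=> Cx; apply/rees_relP; right.
  by move/rees_relP => [->|[]].
- by move=> x x' nCx /= /rees_relP [|[]].
- by move=> q; right; exists (gen_repr q); exact: gen_reprK.
Qed.

(** Gluing [D] to [Y] along the stable set [C]: [Y] is stable in the result,
    because a zigzag from [Y] into [D] must cross [C], and the quotient by [Y]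
    is [D] with [C] collapsed. *)
Lemma glue_flat Y D Z (i : rhom Y Z) (phi : rhom D Z) (C : set D) :
  right_reversible S -> flat_closed_under_stable_rees_extensions S ->
  injective i -> (forall d, C d <-> exists y, i y = phi d) ->
  (forall d d', ~ C d -> phi d = phi d' -> d = d') ->
  (forall z, (exists y, i y = z) \/ exists d, phi d = z) ->
  flat Y -> flat D -> stable_set C -> flat Z.
Proof.
move=> rev closed i_inj CV phi_inj cover Yflat Dflat Cst.
pose V : set Z := [set z | exists y, i y = z].
have VP z s : V z -> V (ract z s) by move=> [y <-]; exists (ract y s); rewrite rhomP.
have V0 : V !=set0 by case: (ract_inhabited Y) => y; exists (i y), y.
pose W := Subact V0 VP.
have [y0 Vy0] := V0.
apply: (closed Z W).
- apply: stable_inclusion => A B f z b z' a Vz e.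
  case: (cover z') => [Vz'|[d dz']]; first by exists z', a.
  have [Cd|nCd] := pselect (C d).
    by exists z', a; split=> //; rewrite /= -dz'; exact/CV.
  have {}e : tens (phi d) (f a) = tens z b by rewrite dz'.
  case: (crossing VP CV phi_inj cover nCd e) => [[d' [nCd' d'z _]]|].
    by case: nCd'; apply/CV; rewrite d'z.
  move=> [c [b1 [Cc E]]]; have [c' [a' [Cc']]] := Cst _ _ _ _ _ _ _ Cc (esym E).
  rewrite -E => /(tens_hom phi (lhom_id B)) /= E'.
  by exists (phi c'), a'; split; [exact/CV | rewrite -e].
- have Vi y : V (i y) by exists y.
  have jP y s : @sub_elt _ _ W _ (Vi (ract y s)) = ract (@sub_elt _ _ W _ (Vi y)) s.
    by apply: val_inj; rewrite /= rhomP.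
  pose j := @RHom S Y (act_of_subact W) _ jP.
  apply: (flat_iso (f := j)) => // [y y' /(congr1 val)|z]; first exact: i_inj.
  by have [y yz] := sub_eltP z; exists y; apply: val_inj.
- apply: (@collapse_flat D _ (rhom_comp (rees_pi W) phi) C (rees_pi W y0)) => //.
  + move=> s; rewrite /= rees_ractE; apply/rees_relP.
    by right; split=> //; exact: (@VP _ s).
  + move=> d /=; rewrite CV; split; first by move=> Vd; apply/rees_relP; right.
    by move/rees_relP => [->|[]].
  + move=> d d' nCd /= /rees_relP [|[/CV //]]; exact: phi_inj.
  + move=> q; rewrite -(gen_reprK q); case: (cover (gen_repr q)) => [Vq|[d dq]].
      by left; apply/rees_relP; right.
    by right; exists d; rewrite /= dq.
Qed.

End Stability.

(** * Small elementary subacts *)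

(** Names for the elements of the subact generated by one element under the
    action and under choices of solutions of zigzags.  The type depends on the
    monoid only, so every subact named by it is small. *)
Inductive term (S : monoidType) : Type :=
| Base
| Act (k : term S) (s : S)
| Back (in_C : bool) (s : S) (w : word S) (k : term S)
| BackTo (s : S) (w : word S) (k k' : term S).

Arguments Base {S}.

Section Hull.
Variables (S : monoidType) (F : rightAct S) (C : set F) (x0 : F).

(** Zigzags to the target set [E] are solved one backward step at a time, so
    that a set closed under these choices contains whole zigzags. *)
Definition back (E : set F) (s : S) (w : word S) (x : F) : F :=
  xget (x : {classic F}) [set a | ract a s = x /\ exists2 y, E y & zigR a w y].

(** The flag of [Back] selects the target of the zigzag: the set [C], or any
    element; [BackTo] prescribes the end point. *)
Fixpoint eval (k : term S) : F :=
  match k with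
  | Base => x0
  | Act k s => ract (eval k) s
  | Back in_C s w k => back (if in_C then C else setT) s w (eval k)
  | BackTo s w k k' => back [set eval k'] s w (eval k)
  end.

Lemma hull_neq0 : range eval !=set0. Proof. by exists x0, Base. Qed.

Lemma hullP x s : range eval x -> range eval (ract x s).
Proof. by move=> [k _ <-]; exists (Act k s). Qed.

Definition hull : subact F := Subact hull_neq0 hullP.

(** A zigzag from the hull to [E] can be replaced by one inside the hull, one
    backward step at a time, if the hull is closed under the choices for [E]. *)
Lemma hull_zig (E : set F) :
    (forall s w k, range eval (back E s w (eval k))) ->
  forall w (u : act_of_subact hull) y, E y -> zigR (val u) w y ->
  exists2 v : act_of_subact hull, E (val v) & zigR u w v.
Proof.
move=> Eback; elim=> [|[[] s] w IH] u y Ey /=.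
- by move=> uy; exists u; rewrite ?uy.
- move=> [a au r]; have [k _ ku] := sub_eltP u.
  have := @xgetPex {classic F} (val u)
    [set a | ract a s = val u /\ exists2 y, E y & zigR a w y].
  case; first by exists a; split=> //; exists y.
  rewrite -/(back E s w (val u)) => b_u [z Ez bz].
  have Db : range eval (back E s w (val u)) by rewrite -ku; exact: Eback.
  have [v Ev r'] := IH (@sub_elt _ _ hull _ Db) z Ez bz.
  by exists v => //; eexists; last exact: r'; apply: val_inj.
- move=> r; exact: (IH (ract (u : act_of_subact hull) s) y Ey r).
Qed.

Lemma hull_stable : stable_set (subact_set hull).
Proof.
move=> A B f c b x a Dc /tens_zig [w r l].
have Eback s v k : range eval (back setT s v (eval k)) by exists (Back false s v k).
have [y _ r'] := hull_zig Eback (u := @sub_elt _ _ hull _ Dc) I r.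
exists (val y), a; split; first exact: sub_eltP y.
exact: (tens_hom (inclusion hull) (lhom_id B) (zig_tens r' l)).
Qed.

Lemma hull_trace_stable :
  stable_set C -> stable_set (C \o val : set (act_of_subact hull)).
Proof.
move=> Cst A B f c b x a Cc /(tens_hom (inclusion hull) (lhom_id B)) /= e.
have [c' [a' [Cc']]] := Cst _ _ _ _ _ _ _ Cc e.
move=> /tens_zig [w r l].
have Eback s v k : range eval (back C s v (eval k)) by exists (Back true s v k).
have [y Cy r'] := hull_zig Eback (u := c) Cc' r.
by exists y, a'; split=> //; exact: zig_tens r' l.
Qed.

(** An equality over the larger left act holds over the smaller one in [F]; the
    zigzag witnessing this has both ends in the hull and is moved into it. *)
Lemma hull_flat : flat F -> flat (act_of_subact hull).
Proof.
move=> Fflat; apply: tens_flat => A B f fi x a x' a'.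
move=> /(tens_hom (inclusion hull) (lhom_id B)) /=.
move=> /(flat_tens Fflat fi) /tens_zig [w r l].
have Eback s v k : range eval (back [set val x'] s v (eval k)).
  by have [k' _ <-] := sub_eltP x'; exists (BackTo s v k k').
have [y /val_inj -> r'] := hull_zig Eback (u := x) erefl r.
exact: zig_tens r' l.
Qed.

Lemma hull_small : exists e : act_of_subact hull -> term S, injective e.
Proof.
have name (u : act_of_subact hull) : {k | eval k = val u}.
  by apply: cid; have [k _ ku] := sub_eltP u; exists k.
exists (fun u => sval (name u)) => u v E; apply: val_inj.
by rewrite -(svalP (name u)) E (svalP (name v)).
Qed.

End Hull.

(** * The complex of small flat cells over an act *)

Section CellComplex.
Variables (S : monoidType) (A : rightAct S) (K : Type).

(** The elements of the complex are well-founded trees.  A cell is an act [D]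
    with elements named in [K], with a set [C] of elements, a map [v] from [D] to
    [A], and an attaching map [u] from [C] to the complex over [v]; a new element
    [cell D C v u d] is added for each [d] in [D] outside of [C].  The inductive
    type iterates the gluing of all cells transfinitely at once; [dummy] is a
    default value for attaching maps. *)
Inductive tree : Type :=
| dummy
| cell (D : K -> Prop) (op : K -> S -> K) (C : K -> Prop) (v : K -> A)
    (u : K -> tree) (d : K).

Definition tree_act (x : tree) (s : S) : tree :=
  if x is cell D op C v u d then
    if pselect (C (op d s)) then u (op d s) else cell D op C v u (op d s)
  else dummy.

Variable a0 : A.

Definition tree_map (x : tree) : A := if x is cell _ _ _ v _ d then v d else a0.

(** The act [D] of a cell is given by its operations on names rather than as an
    act, so that the labels of trees stay in a small type. *)
Record flat_cell (D : K -> Prop) (op : K -> S -> K) (C : K -> Prop)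
    (v : K -> A) : Prop := FlatCell {
  fc_act : exists (E : rightAct S) (e : E -> K),
    [/\ injective e, forall k, D k <-> exists x, e x = k,
        forall x s, op (e x) s = e (ract x s), flat E & stable_set (C \o e)];
  fc_sub : forall k, C k -> D k;
  fc_closed : forall k s, C k -> C (op k s);
  fc_map : forall k s, D k -> v (op k s) = ract (v k) s }.

Fixpoint valid (x : tree) : Prop :=
  if x is cell D op C v u d then
    [/\ flat_cell D op C v, D d, ~ C d &
        forall k, C k -> [/\ valid (u k), tree_map (u k) = v k &
          forall s, tree_act (u k) s = u (op k s)]]
  else False.

Lemma valid_act x s : valid x -> valid (tree_act x s).
Proof.
case: x => //= D op C v u d [fc Dd _ Cu]; case: pselect => [Cds|nCds] /=.
  by case: (Cu _ Cds).
split=> //; have [[E [e [_ De eop _ _]]] _ _ _] := fc.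
by move: Dd; rewrite !De => -[x <-]; exists (ract x s); rewrite eop.
Qed.

Lemma tree_actM x s t :
  valid x -> tree_act (tree_act x s) t = tree_act x (s * t)%g.
Proof.
case: x => //= D op C v u d [fc Dd nCd Cu].
have E : op (op d s) t = op d (s * t)%g.
  have [[E [e [_ De eop _ _]]] _ _ _] := fc.
  by have [x <-] := (De d).1 Dd; rewrite !eop ractM.
rewrite -E; case: pselect => [Cds|nCds] //=.
case: pselect => [?|[]]; last exact: (fc_closed fc).
by case: (Cu _ Cds) => _ _ ->.
Qed.

Lemma tree_act1 x : valid x -> tree_act x 1%g = x.
Proof.
case: x => //= D op C v u d [fc Dd nCd Cu].
have E : op d 1%g = d.
  have [[E [e [_ De eop _ _]]] _ _ _] := fc.
  by have [x <-] := (De d).1 Dd; rewrite !eop ract1.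
by rewrite E; case: pselect.
Qed.

Lemma tree_mapP x s : valid x -> tree_map (tree_act x s) = ract (tree_map x) s.
Proof.
case: x => //= D op C v u d [fc Dd nCd Cu]; rewrite -(fc_map fc) //.
by case: pselect => // Cds; case: (Cu _ Cds).
Qed.

Section Complex.
Hypothesis valid0 : exists x, valid x.

Definition complex_act (x : {x | valid x}) s : {x | valid x} :=
  exist _ (tree_act (sval x) s) (valid_act s (svalP x)).

Lemma complexE (x y : {x | valid x}) : sval x = sval y -> x = y.
Proof. by case: x y => x vx [y vy] /= E; exact: eq_exist. Qed.

Lemma complex_actM x s t : complex_act (complex_act x s) t = complex_act x (s * t)%g.
Proof. by apply: complexE; rewrite /= tree_actM //; exact: svalP. Qed.

Lemma complex_act1 x : complex_act x 1%g = x.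
Proof. by apply: complexE; rewrite /= tree_act1 //; exact: svalP. Qed.

Lemma complex_inhabited : inhabited {x | valid x}.
Proof. by case: valid0 => x vx; split; exists x. Qed.

Definition complex : rightAct S :=
  RightAct complex_actM complex_act1 complex_inhabited.

Definition complex_map : rhom complex A :=
  @RHom S complex A (fun x => tree_map (sval x))
    (fun x s => tree_mapP s (svalP x)).

(** Consider flat subacts that contain a cell as soon as they contain one of
    its new elements.  They are closed under unions of chains, so there is
    a maximal one; it contains every element, by induction on trees: once it
    contains the boundary of a cell, gluing the cell gives a flat subact. *)
Lemma complex_flat :
  right_reversible S -> flat_closed_under_stable_rees_extensions S ->
  flat complex.
Proof.
move=> rev closed.
(* saturation makes the part of a new cell that lies in [Y] exactly its
   boundary *)
pose saturated (Y : set complex) := forall D op C v u d d' vd vd',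
  Y (exist _ (cell D op C v u d) vd) -> Y (exist _ (cell D op C v u d') vd').
pose P (Y : set complex) := [/\ forall x s, Y x -> Y (ract x s), saturated Y &
  forall Z : subact complex, subact_set Z = Y -> flat (act_of_subact Z)].
have [G GP Gtot|Y [[YP Ysat Yflat] Ymax]] := @Zorn_bigcup _ P.
  split=> [x s [Y GY Yx]|D op C v u d d' vd vd' [Y GY Yd]|Z ZE].
  - by have [YP _ _] := GP _ GY; exists Y => //; exact: YP.
  - by have [_ Ysat _] := GP _ GY; exists Y => //; exact: Ysat Yd.
  pose I := {Z' : subact complex | G (subact_set Z')}.
  have stage (x : complex) : subact_set Z x -> exists i : I, subact_set (sval i) x.
    rewrite ZE => -[Y GY Yx]; have [YP _ _] := GP _ GY.
    have Y0 : Y !=set0 by exists x.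
    by exists (exist _ (Subact Y0 YP) GY).
  have sub (i : I) : subact_set (sval i) `<=` subact_set Z.
    by move=> x ix; rewrite ZE; exists (subact_set (sval i)) => //; exact: (svalP i).
  apply: (filtered_flat (c := fun i => sub_incl (sub i))) => [|i]; last first.
    by have [_ _ +] := GP _ (svalP i); exact.
  split=> [x|i j|i j x y /(congr1 val) /= xy].
  - have [i ix] := stage (val x) (sub_eltP x).
    by exists i, (sub_elt ix); apply: val_inj.
  - have [ij|ji] := Gtot _ _ (svalP i) (svalP j).
      by exists j, (sub_incl ij), (rhom_id _); split=> z; apply: val_inj.
    by exists i, (rhom_id _), (sub_incl ji); split=> z; apply: val_inj.
  - have [ij|ji] := Gtot _ _ (svalP i) (svalP j).
      by exists j, (sub_incl ij), (rhom_id _); split=> [z|z|]; apply: val_inj.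
    by exists i, (rhom_id _), (sub_incl ji); split=> [z|z|]; apply: val_inj.
suff YT : Y = setT.
  have T0 : [set: complex] !=set0 by have [x] := complex_inhabited; exists x.
  pose T := @Subact S complex setT T0 (fun _ _ => id).
  apply: (flat_iso (f := inclusion T)); first exact: val_inj.
    by move=> y; exists (@sub_elt _ _ T y I).
  by apply: Yflat; rewrite YT.
suff Yall (t : tree) (vt : valid t) : Y (exist _ t vt).
  by apply/seteqP; split=> // -[t vt] _.
elim: t vt => [//|D op C v u uY d] vd.
have [fc Dd nCd Cu] := vd.
have [[E [e [ei De eop Eflat Cst]]] Csub Cclosed _] := fc.
have [x0 x0d] := (De d).1 Dd.
apply: contrapT => nYd.
pose new (z : complex) := exists x, sval z = cell D op C v u (e x).
have newN z : new z -> ~ Y z.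
  by case: z => t vt [x /= tE] Yz; subst t; apply: nYd; exact: Ysat Yz.
pose Y' : set complex := [set z | Y z \/ new z].
have attach k (vk : valid (u k)) : Y (exist _ (u k) vk) by exact: uY.
pose phi0 (y : E) : tree :=
  if pselect (C (e y)) then u (e y) else cell D op C v u (e y).
have phiv y : valid (phi0 y).
  rewrite /phi0; case: pselect => [Cy|nCy]; first by case: (Cu _ Cy).
  by split=> //; apply/De; exists y.
have phiP y s : tree_act (phi0 y) s = phi0 (ract y s).
  rewrite /phi0; case: (pselect (C (e y))) => [Cy|nCy] /=; last by rewrite eop.
  have [_ _ ->] := Cu _ Cy; rewrite eop.
  by case: pselect => // -[]; rewrite -eop; exact: Cclosed.
pose phi1 y : complex := exist _ (phi0 y) (phiv y).
have phiC y : C (e y) -> Y (phi1 y).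
  rewrite /phi1; move: (phiv y); rewrite /phi0.
  by case: pselect => // ? ? _; exact: uY.
have phiN y : ~ C (e y) -> sval (phi1 y) = cell D op C v u (e y).
  by move=> nCy; rewrite /= /phi0; case: pselect.
have Y'cases z : Y' z -> Y z \/ exists2 y, ~ C (e y) & z = phi1 y.
  case=> [|[y zE]]; [by left | right; exists y].
    by have := svalP z; rewrite zE => -[].
  by apply: complexE; rewrite zE phiN //; have := svalP z; rewrite zE => -[].
have Y'phi y : Y' (phi1 y).
  have [/phiC|nCy] := pselect (C (e y)); first by left.
  by right; exists y; exact: phiN.
have phi1P y s : phi1 (ract y s) = ract (phi1 y) s.
  by apply: complexE; rewrite /= phiP.
have phi_inj y y' : ~ C (e y) -> phi1 y = phi1 y' -> y = y'.
  move=> nCy E1; have /newN nY : new (phi1 y) by exists y; exact: phiN.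
  have nCy' : ~ C (e y') by move=> /phiC; rewrite -E1.
  by move: E1 => /(congr1 sval); rewrite !phiN // => -[/ei].
apply: (Ymax Y'); first split.
- by move=> z Yz; left.
- move/(_ (exist _ _ vd)) => sub; apply: nYd; apply: sub.
  by right; exists x0; rewrite x0d.
split.
- move=> z s /Y'cases [Yz|[y _ ->]]; first by left; exact: YP.
  by rewrite -phi1P.
- move=> D1 op1 C1 v1 u1 d1 d2 vd1 vd2 [Yd1|[y /=]]; first by left; exact: Ysat Yd1.
  case=> ? ? ? ? ? _; subst; right; have [_ /De [y' y'd] _ _] := vd2.
  by exists y'; rewrite /= y'd.
move=> Z ZE.
have Zphi y : subact_set Z (phi1 y) by rewrite ZE.
have phiZ y s : sub_elt (Zphi (ract y s)) = ract (sub_elt (Zphi y)) s.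
  by apply: val_inj; exact: phi1P.
pose phi := @RHom S E (act_of_subact Z) _ phiZ.
have Zcases (z : act_of_subact Z) : Y (val z) \/ exists y, phi y = z.
  have /Y'cases [|[y _ zy]] : Y' (val z) by rewrite -ZE; exact: sub_eltP z.
    by left.
  by right; exists y; apply: val_inj.
have phiZ_inj y y' : ~ C (e y) -> phi y = phi y' -> y = y'.
  by move=> nCy /(congr1 val); exact: phi_inj.
(* gluing to the empty set is adding the act [E], with an empty boundary *)
have [Y0|/set0P/negP/negPn/eqP Y0] := pselect (Y !=set0); last first.
  apply: (flat_iso (f := phi)) => // [y y'|z].
    by apply: phiZ_inj => /phiC; rewrite Y0.
  by case: (Zcases z) => //; rewrite Y0.
pose W := Subact Y0 YP.
have WZ : subact_set W `<=` subact_set Z by rewrite ZE => z; left.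
apply: (glue_flat (i := sub_incl WZ) (phi := phi) (C := C \o e)) => //.
- by move=> z z' /(congr1 val) /= /val_inj.
- move=> y; split=> [Cy|[z /(congr1 val) /= zy]].
    by exists (@sub_elt _ _ W _ (phiC _ Cy)); apply: val_inj.
  apply: contrapT => nCy; apply: (newN (phi1 y)); first by exists y; exact: phiN.
  by rewrite -zy; exact: (sub_eltP z).
- move=> z; case: (Zcases z) => [Yz|]; last by right.
  by left; exists (@sub_elt _ _ W _ Yz); apply: val_inj.
- exact: Yflat.
Qed.

End Complex.
End CellComplex.

(** * Flat precovers *)

Section Lifting.
Variables (S : monoidType) (A : rightAct S) (a0 : A).
Local Notation tree := (tree A (term S)).

(** Partial lifts to the complex are extended from a stable domain [C] to the
    union of [C] with a small subact [E] through a given element: [E] with the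
    trace of [C] is one of the cells, attached along the partial lift. *)
Lemma flat_lift (F : rightAct S) (g : rhom F A) : flat F ->
  exists h : F -> tree, forall f,
    [/\ valid a0 (h f), tree_map a0 (h f) = g f &
        forall s, h (ract f s) = tree_act (h f) s].
Proof.
move=> Fflat.
pose dom (G : set (F * tree)) : set F := [set f | exists t, G (f, t)].
pose P (G : set (F * tree)) :=
  [/\ forall f t, G (f, t) -> valid a0 t /\ tree_map a0 t = g f,
      forall f t t', G (f, t) -> G (f, t') -> t = t',
      forall f t s, G (f, t) -> G (ract f s, tree_act t s) &
      stable_set (dom G)].
have [H HP Htot|G [[Gvalid Gfun Gact Gst] Gmax]] := @Zorn_bigcup _ P.
  split.
  - by move=> f t [G HG Gt]; have [/(_ _ _ Gt)] := HP _ HG.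
  - move=> f t t' [G HG Gt] [G' HG' Gt'].
    have [GG'|G'G] := Htot _ _ HG HG'.
      by have [_ Gfun _ _] := HP _ HG'; apply: Gfun Gt'; exact: GG'.
    by have [_ Gfun _ _] := HP _ HG; apply: (Gfun _ _ _ Gt); exact: G'G.
  - by move=> f t s [G HG Gt]; exists G => //; have [_ _ + _] := HP _ HG; apply.
  - move=> B B' l c b x a [t [G HG Gt]] E; have [_ _ _ Gst] := HP _ HG.
    have [|c' [a' [[t' Gt'] E']]] := Gst _ _ l _ _ _ _ _ E; first by exists t.
    by exists c', a'; split=> //; exists t', G.
pose lab f : tree := xget (dummy A (term S) : {classic tree}) [set t | G (f, t)].
have labP f : dom G f -> G (f, lab f).
  move=> /(@xgetPex {classic tree} (dummy A (term S)) [set t | G (f, t)]).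
  exact.
suff domT f : dom G f.
  exists lab => f; have Gf := labP _ (domT f); have [? ?] := Gvalid _ _ Gf.
  by split=> // s; exact: Gfun (labP _ (domT _)) (Gact _ _ s Gf).
apply: contrapT => nGf.
pose E := hull (dom G) f.
have Ef : subact_set E f by exists Base.
have Est : stable_set (subact_set E) by exact: hull_stable.
have Ctrace : stable_set (dom G \o val : set (act_of_subact E)).
  exact: hull_trace_stable.
have [e ei] := hull_small (dom G) f.
rewrite -/E in e ei.
(* names that name nothing are decoded as [f] *)
pose dec k : act_of_subact E :=
  xget (sub_elt Ef : {classic act_of_subact E}) [set x | e x = k].
have decK x : dec (e x) = x.
  apply: ei; apply: (@xgetPex {classic act_of_subact E} _ [set y | e y = e x]).
  by exists x.
pose D k := exists x, e x = k.
pose op k s := e (ract (dec k) s).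
pose C k := D k /\ dom G (val (dec k)).
pose v k := g (val (dec k)).
pose u k := lab (val (dec k)).
have CE (x : act_of_subact E) : C (e x) <-> dom G (val x).
  by rewrite /C decK; split=> [[]//|?]; split=> //; exists x.
have opE x s : op (e x) s = e (ract x s) by rewrite /op decK.
have vP : flat_cell D op C v.
  split=> [|k []|k s|k s [x <-]] //.
  - exists (act_of_subact E), e; split=> //; first exact: hull_flat.
    rewrite (_ : C \o e = dom G \o val) //.
    by apply/seteqP; split=> x /=; rewrite CE.
  - move=> [[x <-]]; rewrite decK opE => -[t Gt]; apply/CE.
    by exists (tree_act t s); exact: Gact.
  - by rewrite opE /v !decK -rhomP.
pose new x : tree := cell D op C v u (e x).
have newP x : ~ dom G (val x) -> valid a0 (new x).
  move=> nGx; split=> // [|/CE //|k]; first by exists x.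
  move=> [[y <-]]; rewrite decK => Gy.
  have [? ?] := Gvalid _ _ (labP _ Gy); rewrite /u /v !decK; split=> // s.
  rewrite opE decK.
  apply: Gfun (Gact _ _ s (labP _ Gy)) (labP _ _).
  by exists (tree_act (lab (val y)) s); apply/Gact/labP.
pose G' := G `|` [set q | exists x : act_of_subact E,
  ~ dom G (val x) /\ q = (val x, new x)].
apply: (Gmax G'); first split=> [q Gq|sub]; first by left.
  apply: (nGf); exists (new (sub_elt Ef)); apply: sub; right.
  by exists (sub_elt Ef); split.
split.
- move=> h t [/Gvalid //|[x [nGx [-> ->]]]].
  by split; [exact: newP | rewrite /= /v decK].
- move=> h t t' [Gt|[x [nGx [-> ->]]]] [Gt'|[y [nGy]]].
  + exact: Gfun Gt Gt'.
  + by case=> hy _; case: nGy; exists t; move: Gt; rewrite hy.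
  + by case: nGx; exists t'.
  + by case=> /val_inj -> ->.
- move=> h t s [Gt|[x [nGx [-> ->]]]]; first by left; exact: Gact.
  rewrite /new /= opE; case: pselect => [/CE Gxs|/CE nGxs] /=; last first.
    by right; exists (ract x s).
  by left; rewrite /u decK; exact: (labP _ Gxs).
- rewrite (_ : dom G' = dom G `|` subact_set E); first exact: stable_setU.
  apply/seteqP; split=> h.
    move=> [t [Gt|[x [_ [-> _]]]]]; first by left; exists t.
    by right; exact: (sub_eltP x).
  have [[t Gt]|nGh] := pselect (dom G h); first by exists t; left.
  by case=> // Eh; exists (new (sub_elt Eh)); right; exists (sub_elt Eh).
Qed.

Lemma flat_precover :
  right_reversible S -> flat_closed_under_stable_rees_extensions S ->
  exists (X : rightAct S) (p : rhom X A), is_precover (@flat S) p.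
Proof.
move=> rev closed.
(* the lift of an orbit map shows that there is a valid tree *)
have valid0 : exists t : tree, valid a0 t.
  have [h hP] := flat_lift (rorbit a0) (@rreg_flat S).
  by exists (h 1%g); case: (hP 1%g).
exists (complex valid0), (complex_map valid0).
split; first exact: complex_flat.
move=> F g /(flat_lift g) [h hP].
have hv f : valid a0 (h f) by case: (hP f).
have hact f s : (exist _ (h (ract f s)) (hv _) : complex valid0) =
    ract (exist _ (h f) (hv f) : complex valid0) s.
  by apply: complexE => /=; case: (hP f) => _ _ ->.
by exists (@RHom S F (complex valid0) _ hact) => f /=; case: (hP f).
Qed.

End Lifting.

(** * From precovers to covers *)

Lemma no_powerset_injection (T : Type) (f : set T -> T) : ~ injective f.
Proof.
move=> fi; pose D := [set t | exists Y, f Y = t /\ ~ Y t].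
have nD : ~ D (f D) by move=> [Y [/fi -> nD]]; apply: (nD); exists D.
by apply: (nD); exists D.
Qed.

Lemma strict_well_order (T : Type) : exists lt : T -> T -> Prop,
  [/\ well_founded lt, forall x y z, lt x y -> lt y z -> lt x z,
      forall x y, [\/ lt x y, x = y | lt y x] &
      forall x0 : T, exists m, forall x, x <> m -> lt m x].
Proof.
have [R Rwo] := well_ordering_principle {classic T}.
have Rchain : wo_chain R predT by move=> A _; exact: Rwo.
have Rtot x y : R x y || R y x by exact: (wo_chainW Rchain).
have Ranti x y : R x y -> R y x -> x = y.
  by move=> xy yx; apply: (wo_chain_antisymmetric Rchain) => //; apply/andP.
exists (fun x y => ~~ R y x); split.
- move=> x; apply: contrapT => nx.
  have [|z [[/asboolP nz zmin] _]] := Rwo [pred y | `[< ~ Acc (fun x y => ~~ R y x) y >]].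
    by exists x; apply/asboolP.
  apply: nz; split=> y nzy; apply: contrapT => ny.
  by move/negP: nzy; apply; apply: zmin; apply/asboolP.
- move=> x y z nyx nzy; apply/negP => zx.
  have [|m [[+ mmin] _]] := Rwo [pred w : {classic T} | [|| w == x, w == y | w == z]].
    by exists x; rewrite inE eqxx.
  have mx : R m x by apply: mmin; rewrite inE eqxx.
  have my : R m y by apply: mmin; rewrite inE eqxx orbT.
  have mz : R m z by apply: mmin; rewrite inE eqxx !orbT.
  case/or3P=> /eqP mE; last by move: nzy; rewrite -mE my.
    have := Ranti x z; rewrite -{1}mE => /(_ mz zx) xz.
    by move: (Rtot y z); rewrite (negPf nzy) -xz (negPf nyx).
  by move: nyx; rewrite -mE mx.
- move=> x y; case: (boolP (R x y)) => xy; last by constructor 3.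
  case: (boolP (R y x)) => yx; last by constructor 1.
  by constructor 2; exact: Ranti.
- move=> x0; have [|m [[_ mmin] _]] := Rwo predT; first by exists x0.
  exists m => x xm; apply/negP => Rxm; apply: xm.
  by apply: Ranti => //; exact: mmin.
Qed.

Record directed_system (S : monoidType) (X : rightAct S) (I : Type)
    (R : I -> I -> Prop) (d : I -> I -> rhom X X) : Prop := DirectedSystem {
  ds_refl : forall i, R i i;
  ds_trans : forall i j k, R i j -> R j k -> R i k;
  ds_dir : forall i j, exists2 k, R i k & R j k;
  ds_id : forall i, d i i =1 id;
  ds_comp : forall i j k, R i j -> R j k -> d j k \o d i j =1 d i k }.

Section Colimit.
Variables (S : monoidType) (X : rightAct S) (I : Type) (R : I -> I -> Prop).
Variable d : I -> I -> rhom X X.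
Hypothesis I0 : inhabited I.
Hypothesis ds : directed_system R d.

Definition colim_rel (p q : I * X) : Prop :=
  exists k, [/\ R p.1 k, R q.1 k & d p.1 k p.2 = d q.1 k q.2].

Lemma colimP p q : gen_pi colim_rel p = gen_pi colim_rel q <-> colim_rel p q.
Proof.
rewrite gen_piP; split=> [|?]; last exact: rst_step.
elim=> // {p q} [p|p q _ [k [? ? ?]]|p q r _ [k [pk qk E]] _ [l [ql rl E']]].
- by exists p.1; split=> //; exact: ds_refl ds _.
- by exists k.
- have [m km lm] := ds_dir ds k l; exists m.
  split; [exact: ds_trans ds _ _ _ pk km | exact: ds_trans ds _ _ _ rl lm |].
  by rewrite -(ds_comp ds pk km) -(ds_comp ds rl lm) /= E -E' -[d k m _]/((d k m \o d _ _) _)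
    (ds_comp ds qk km) -[d l m _]/((d l m \o d _ _) _) (ds_comp ds ql lm).
Qed.

Definition colim_ract (q : gen_quot colim_rel) (s : S) : gen_quot colim_rel :=
  gen_map colim_rel (fun p => (p.1, ract p.2 s)) q.

Lemma colim_ractE p s :
  colim_ract (gen_pi colim_rel p) s = gen_pi colim_rel (p.1, ract p.2 s).
Proof.
apply: (gen_mapE (f := fun p => (p.1, ract p.2 s))) => x y [k [xk yk E]].
by apply: rst_step; exists k; split=> //=; rewrite !rhomP E.
Qed.

Lemma colim_ractM q s t : colim_ract (colim_ract q s) t = colim_ract q (s * t)%g.
Proof. by rewrite -(gen_reprK q) !colim_ractE ractM. Qed.

Lemma colim_ract1 q : colim_ract q 1%g = q.
Proof. by rewrite -(gen_reprK q) colim_ractE ract1 -surjective_pairing. Qed.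

Lemma colim_inhabited : inhabited (gen_quot colim_rel).
Proof.
by case: I0 => i; case: (ract_inhabited X) => x; split; exact: (gen_pi _ (i, x)).
Qed.

Definition colim : rightAct S :=
  RightAct colim_ractM colim_ract1 colim_inhabited.

Definition colim_in i : rhom X colim :=
  @RHom S X colim (fun x => gen_pi colim_rel (i, x))
    (fun x s => esym (colim_ractE (i, x) s)).

Lemma colim_in_surj q : exists i x, colim_in i x = q.
Proof.
rewrite -(gen_reprK q); case: (gen_repr q) => i x.
by exists i, x.
Qed.

Lemma colim_in_eq i j x y : colim_in i x = colim_in j y ->
  exists k, [/\ R i k, R j k & d i k x = d j k y].
Proof. by move/colimP. Qed.

Lemma colim_in_comp i j : R i j -> colim_in j \o d i j =1 colim_in i.
Proof. by move=> ij x; apply/colimP; exists j; split=> //=; [exact: ds_refl ds _ | rewrite (ds_id ds)]. Qed.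

Lemma colim_filtered : filtered_colimit colim_in.
Proof.
split=> [|i j|i j x y /colim_in_eq [k [ik jk E]]]; first exact: colim_in_surj.
  have [k ik jk] := ds_dir ds i j.
  by exists k, (d i k), (d j k); split; exact: colim_in_comp.
by exists k, (d i k), (d j k); split=> //; exact: colim_in_comp.
Qed.

Lemma colim_factor (A : rightAct S) (p : rhom X A) :
  (forall i j, R i j -> p \o d i j =1 p) ->
  exists q : rhom colim A, forall i, q \o colim_in i =1 p.
Proof.
move=> pd; pose q (z : colim) : A := p (gen_repr z).2.
have qE i x : q (colim_in i x) = p x.
  have /colimP [k [/= ik jk E]] := gen_reprK (colim_in i x).
  exact: etrans (esym (pd _ _ ik _)) (etrans (congr1 p E) (pd _ _ jk _)).
have qP z s : q (ract z s) = ract (q z) s.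
  by have [i [x <-]] := colim_in_surj z; rewrite -rhomP !qE rhomP.
by exists (RHom qP).
Qed.

End Colimit.

Definition filtered_closed (S : monoidType) (C : rightAct S -> Prop) : Prop :=
  forall X I (Xi : I -> rightAct S) (c : forall i, rhom (Xi i) X),
    inhabited I -> filtered_colimit c -> (forall i, C (Xi i)) -> C X.

Definition over (S : monoidType) (X A : rightAct S) (p : rhom X A)
  (f : rhom X X) : Prop := p \o f =1 p.

Section Endomorphisms.
Variables (S : monoidType) (C : rightAct S -> Prop) (A P : rightAct S).
Variable p : rhom P A.
Hypothesis Cclosed : filtered_closed C.
Hypothesis pP : is_precover C p.

Lemma over_id : over p (rhom_id P). Proof. by []. Qed.

Lemma over_comp f g : over p g -> over p f -> over p (rhom_comp g f).
Proof. by move=> pg pf x /=; rewrite -[p _]/((p \o g) _) pg -[p _]/((p \o f) _) pf. Qed.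

(** Every chain of endomorphisms over [A] has a cocone with vertex [P]: its
    colimit is again in the class, hence maps to the precover. *)
Lemma chain_cocone (W : Type) (lt : W -> W -> Prop) (U : set W)
    (d : W -> W -> rhom P P) :
  (forall i j k, lt i j -> lt j k -> lt i k) ->
  (forall i j, [\/ lt i j, i = j | lt j i]) ->
  (forall i, ~ lt i i) ->
  (forall i j, U i -> U j -> lt i j -> over p (d i j)) ->
  (forall i j k, U i -> U j -> U k -> lt i j -> lt j k ->
     d j k \o d i j =1 d i k) ->
  exists c : W -> rhom P P, (forall i, over p (c i)) /\
    forall i j, U i -> U j -> lt i j -> c j \o d i j =1 c i.
Proof.
move=> ltT ltt ltx dp dc.
have [[w Uw]|U0] := pselect (U !=set0); last first.
  by exists (fun=> rhom_id P); split=> // i j Ui; case: U0; exists i.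
pose I := {i | U i}; pose R (i j : I) := sval i = sval j \/ lt (sval i) (sval j).
pose dd (i j : I) : rhom P P :=
  if pselect (sval i = sval j) then rhom_id P else d (sval i) (sval j).
have ddE (i j : I) : lt (sval i) (sval j) -> dd i j = d (sval i) (sval j).
  by rewrite /dd; case: pselect => //= -> /ltx.
have ddx (i j : I) : sval i = sval j -> dd i j = rhom_id P.
  by rewrite /dd; case: pselect.
have ddp i j : R i j -> over p (dd i j).
  case=> [/ddx ->|ij]; first exact: over_id.
  by rewrite ddE //; apply: dp => //; [exact: svalP i | exact: svalP j].
have I0 : inhabited I by split; exists w.
have Rxx i : R i i by left.
have RT i j k : R i j -> R j k -> R i k.
  case=> [ij|ij] [jk|jk]; rewrite /R.
  - by left; exact: etrans ij jk.
  - by right; rewrite ij.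
  - by right; rewrite -jk.
  - by right; exact: ltT jk.
have Rdir i j : exists2 k, R i k & R j k.
  case: (ltt (sval i) (sval j)) => ij.
  - by exists j; [right | left].
  - by exists j; left.
  - by exists i; [left | right].
have ddc i j k : R i j -> R j k -> dd j k \o dd i j =1 dd i k.
  case=> [ij|ij] [jk|jk].
  - by rewrite !ddx //; exact: etrans ij jk.
  - by rewrite (ddx _ _ ij) /dd ij.
  - by rewrite (ddx _ _ jk) /dd jk.
  - rewrite !ddE //; last exact: ltT jk.
    by apply: dc => //; [exact: svalP i | exact: svalP j | exact: svalP k].
have ddxx i : dd i i =1 id by rewrite ddx.
have ds := DirectedSystem Rxx RT Rdir ddxx ddc.
pose c0 := colim_in R dd I0.
have [q qP] := colim_factor I0 ds ddp.
have CL := Cclosed I0 (colim_filtered I0 ds) (fun=> pP.1).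
have [h hP] := pP.2 _ q CL.
exists (fun i => if pselect (U i) is left Ui then rhom_comp h (c0 (exist _ i Ui))
  else rhom_id P); split=> [i|i j Ui Uj ij x].
  case: pselect => // Ui x /=; rewrite -[p _]/((p \o h) _) hP; exact: qP.
case: pselect => // Uj'; case: pselect => // Ui' /=; congr (h _).
rewrite -(ddE (exist U i Ui') (exist U j Uj') ij).
have R' : R (exist U i Ui') (exist U j Uj') by right.
exact (colim_in_comp I0 ds R' x).
Qed.

(** Transfinite composition along a well-order [lt]: at stage [k] a cocone
    [c k] over the stages below [k] is chosen, followed by [sigma (c k w0)], so
    that the map from stage [i] to stage [k] is [sigma (c k w0) \o c k i].  As all
    stages are [P], the maps are constructed by plain well-founded recursion. *)
Lemma transfinite_chain (W : Type) (lt : W -> W -> Prop) (w0 : W)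
    (sigma : rhom P P -> rhom P P) :
  well_founded lt -> (forall i j k, lt i j -> lt j k -> lt i k) ->
  (forall i j, [\/ lt i j, i = j | lt j i]) ->
  (forall f, over p f -> over p (sigma f)) ->
  exists c : W -> W -> rhom P P,
    [/\ forall k i, over p (c k i),
        forall i j k, lt i j -> lt j k ->
          c k j \o (sigma (c j w0) \o c j i) =1 c k i &
        exists c' : W -> rhom P P, (forall i, over p (c' i)) /\
          forall i j, lt i j -> c' j \o (sigma (c j w0) \o c j i) =1 c' i].
Proof.
move=> ltwf ltT ltt sigmaP.
have ltx i : ~ lt i i by elim: (ltwf i) => j _ IH jj; exact: (IH j).
pose Phi k (rec : forall j, lt j k -> W -> rhom P P) : W -> rhom P P :=
  xget ((fun=> rhom_id P) : {classic W -> rhom P P})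
    [set c | (forall i, over p (c i)) /\ forall i j (ij : lt i j) (jk : lt j k),
      c j \o (sigma (rec j jk w0) \o rec j jk i) =1 c i].
pose c := Fix ltwf (fun=> W -> rhom P P) Phi.
have cE k : c k = Phi k (fun j _ => c j).
  rewrite /c Fix_eq // => {}k f g fg; congr (Phi k).
  by apply: functional_extensionality_dep => j; apply: functional_extensionality_dep.
have cocone (U : set W) : (forall k, U k -> (forall i, over p (c k i)) /\
      forall i j, lt i j -> lt j k -> c k j \o (sigma (c j w0) \o c j i) =1 c k i) ->
    exists c' : W -> rhom P P, (forall i, over p (c' i)) /\
      forall i j, U i -> U j -> lt i j -> c' j \o (sigma (c j w0) \o c j i) =1 c' i.
  move=> IH; apply: (chain_cocone (d := fun i j => rhom_comp (sigma (c j w0)) (c j i))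
    ltT ltt ltx) => [i j Ui Uj ij|i j k Ui Uj Uk ij jk x /=].
    have [cj _] := IH j Uj.
    by apply: over_comp => //; exact: sigmaP.
  by congr (sigma _ _); have [_ cij] := IH k Uk; exact: cij.
have cP k : (forall i, over p (c k i)) /\
    forall i j, lt i j -> lt j k -> c k j \o (sigma (c j w0) \o c j i) =1 c k i.
  elim: (ltwf k) => {}k _ IH; rewrite [c k]cE.
  have [c' [c'p c'c]] := cocone [set j | lt j k] IH.
  apply: (@xgetPex {classic W -> rhom P P} _ [set c' | (forall i, over p (c' i)) /\
    forall i j, lt i j -> lt j k -> c' j \o (sigma (c j w0) \o c j i) =1 c' i]).
  by exists c'; split=> // i j ij jk; apply: c'c => //; exact: ltT jk.
exists c; split=> [k|i j k|].
- by case: (cP k).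
- by case: (cP k) => _; apply.
- have [|c' [c'p c'c]] := cocone setT; first by move=> k _; exact: cP.
  by exists c'; split=> // i j; exact: c'c.
Qed.

(** If there were no such [f], a long enough chain would identify a new pair of
    elements of its first stage at each later stage; the chain is indexed by
    a set larger than the set of pairs. *)
Lemma stable_kernel : exists2 f, over p f &
  forall g, over p g -> forall x y, g (f x) = g (f y) -> f x = f y.
Proof.
apply: contrapT => none.
have grow f : over p f -> exists g, over p g /\
    exists q : P * P, g (f q.1) = g (f q.2) /\ f q.1 <> f q.2.
  move=> pf; apply: contrapT => stuck; apply: none; exists f => // g pg x y E.
  by apply: contrapT => ne; apply: stuck; exists g; split=> //; exists (x, y).
pose sigma f : rhom P P := xget (rhom_id P : {classic rhom P P})
  [set g | over p g /\ exists q : P * P, g (f q.1) = g (f q.2) /\ f q.1 <> f q.2].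
have sigmaP f : over p f -> over p (sigma f) /\ exists q : P * P,
    sigma f (f q.1) = sigma f (f q.2) /\ f q.1 <> f q.2.
  by move=> /grow /(@xgetPex {classic rhom P P} (rhom_id P)).
pose W := set (option (P * P)).
have [lt [ltwf ltT ltt /(_ set0) [w0 ltmin]]] := strict_well_order W.
have sigmap f : over p f -> over p (sigma f) by case/sigmaP.
have [c [cp cc _]] := transfinite_chain w0 ltwf ltT ltt sigmap.
have new k : {q : P * P | sigma (c k w0) (c k w0 q.1) = sigma (c k w0) (c k w0 q.2) /\
    c k w0 q.1 <> c k w0 q.2}.
  by apply: cid; have [] := sigmaP _ (cp k w0).
have new_inj i j : i <> w0 -> lt i j -> sval (new i) <> sval (new j).
  move=> iw ij E; have [_ ne] := svalP (new j); apply: ne; rewrite -E.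
  have [Ei _] := svalP (new i).
  by rewrite -!(cc _ _ _ (ltmin _ iw) ij) /= Ei.
(* the first stage has no map to itself in the chain, so the least index is
   sent to the extra element *)
pose F k := if pselect (k = w0) then None else Some (sval (new k)).
apply: (@no_powerset_injection _ F) => i j; rewrite /F.
case: pselect => iw; case: pselect => jw //=; first by rewrite iw jw.
case=> E.
case: (ltt i j) => // ij; first by case: (new_inj _ _ iw ij).
by case: (new_inj _ _ jw ij).
Qed.

Lemma iter_act (f : rhom P P) n x s : iter n f (ract x s) = ract (iter n f x) s.
Proof. by elim: n => //= n ->; rewrite rhomP. Qed.

(** The colimit of the iterates of the endomorphism [f] of [stable_kernel]:
    two elements that some endomorphism identifies come from elements of [P]
    whose images under [f] are identified, hence equal one stage later. *)
Lemma precover_mono_endo : exists (X : rightAct S) (q : rhom X A),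
  is_precover C q /\ forall g : rhom X X, over q g -> injective g.
Proof.
have [f pf fker] := stable_kernel.
pose d (i j : nat) := RHom (iter_act f (j - i)).
have RT i j k : (i <= j)%N -> (j <= k)%N -> (i <= k)%N by exact: leq_trans.
have Rdir i j : exists2 k, (i <= k)%N & (j <= k)%N.
  by exists (maxn i j); rewrite ?leq_maxl ?leq_maxr.
have dxx i : d i i =1 id by move=> x; rewrite /= subnn.
have dc i j k : (i <= j)%N -> (j <= k)%N -> d j k \o d i j =1 d i k.
  by move=> ij jk x; rewrite /= -iterD addnBA // subnK.
have dp i j : (i <= j)%N -> over p (d i j).
  move=> _ x /=; elim: (j - i) => //= n <-; exact: pf.
have I0 : inhabited nat by split; exact: 0.
have ds : directed_system (fun i j => i <= j)%N d by split.
pose X := colim (fun i j => i <= j)%N d I0.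
pose c := colim_in (fun i j => i <= j)%N d I0.
have [q qc] := colim_factor I0 ds dp.
have CX : C X := Cclosed I0 (colim_filtered I0 ds) (fun=> pP.1).
exists X, q; split.
  split=> // Y g CY; have [h hP] := pP.2 _ g CY.
  by exists (rhom_comp (c 0) h) => y; rewrite -hP; exact: qc.
move=> g qg; have [h hP] := pP.2 _ q CX.
have step n x : c n x = c n.+1 (f x).
  rewrite -(colim_in_comp I0 ds (leqnSn n)) /=.
  by rewrite subSnn.
move=> x y.
have [i [x' <-]] := colim_in_surj x.
have [j [y' <-]] := colim_in_surj y.
have [k ik jk] := Rdir i j.
rewrite -(colim_in_comp I0 ds ik x') -(colim_in_comp I0 ds jk y').
rewrite -[LHS]/(g (c k (d i k x'))) -[RHS]/(g (c k (d j k y'))) !(step k) => E.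
rewrite -[LHS]/(c k (d i k x')) -[RHS]/(c k (d j k y')) !(step k); congr (c _ _).
apply: (fker (rhom_comp h (rhom_comp g (c k.+1)))); last by rewrite /= E.
move=> z /=; rewrite -[p _]/((p \o h) _) hP -[q _]/((q \o g) _) qg; exact: qc.
Qed.

(** If some endomorphism [f] were injective and not surjective, the images of
    the stages of a chain of copies of [f] would grow strictly inside [P], for
    longer than the size of [P] allows. *)
Lemma mono_endo_cover :
  (forall g : rhom P P, over p g -> injective g) -> is_cover C p.
Proof.
move=> inj; split=> // f pf.
suff fsurj y : exists x, f x = y.
  pose k y := sval (cid (fsurj y)).
  have fk : cancel k f by move=> y; exact: svalP (cid (fsurj y)).
  have kP y s : k (ract y s) = ract (k y) s.
    by apply: (inj f pf); rewrite rhomP !fk.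
  by exists (RHom kP); split=> // x; apply: (inj f pf); rewrite fk.
apply: contrapT => fy.
have [lt [ltwf ltT ltt _]] := strict_well_order (set P).
have [c [cp cc [c' [c'p c'c]]]] :=
  transfinite_chain set0 (sigma := fun=> f) ltwf ltT ltt (fun _ _ => pf).
have c'_inj i j : lt i j -> c' i y <> c' j y.
  move=> ij; rewrite -(c'c _ _ ij) /= => /(inj _ (c'p j)) E.
  by apply: fy; eexists; exact: E.
apply: (@no_powerset_injection _ (fun i => c' i y)) => i j E.
by case: (ltt i j) => // ij; case: (c'_inj _ _ ij).
Qed.

End Endomorphisms.

Lemma cover_of_precover (S : monoidType) (C : rightAct S -> Prop)
    (A P : rightAct S) (p : rhom P A) :
  filtered_closed C -> is_precover C p -> has_cover C A.
Proof.
move=> Cclosed pP; have [X [q [qP qinj]]] := precover_mono_endo Cclosed pP.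
by exists X, q; exact: mono_endo_cover.
Qed.

(** * Acts with a unique fixed point *)

Section UniqueFixedPoint.
Variables (S : monoidType) (z : S).
Hypothesis zP : is_left_zero z.
Implicit Type X : rightAct S.

Lemma fixed_zero X (x : X) : fixed_point (ract x z).
Proof. by move=> s; rewrite ractM zP. Qed.

Lemma act0_filtered_closed : filtered_closed (@in_act0 S).
Proof.
move=> X I Xi c [i0] [csurj cdir _] X0.
have [o [oP _]] := X0 i0; exists (c i0 o); split=> [s|x xP].
  by rewrite -rhomP oP.
have [i [y cy]] := csurj x; have [k [g [h [cg ch]]]] := cdir i0 i.
have [o' [_ o'P]] := X0 k.
rewrite -(xP z) -cy -rhomP -cg -ch /=; congr (c k _).
transitivity o'; [apply/esym/o'P | apply: o'P] => s; rewrite -rhomP ?oP //.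
by rewrite fixed_zero.
Qed.

Lemma fixed_neq0 X : [set x : X | fixed_point x] !=set0.
Proof. by case: (ract_inhabited X) => x; exists (ract x z); exact: fixed_zero. Qed.

Lemma fixed_ract X x s : fixed_point x -> fixed_point (ract x s : X).
Proof. by move=> xP; rewrite xP. Qed.

Definition fixed_subact X : subact X := Subact (fixed_neq0 X) (@fixed_ract X).

(** A zigzag starting at a fixed point can be replaced by a constant one. *)
Lemma fixed_stable X : stable_set [set x : X | fixed_point x].
Proof.
move=> B B' f c b x a cP /tens_zig [w _ l]; exists c, a; split=> //.
apply: zig_tens l; elim: w => //= -[[] s] w IH; last by rewrite cP.
by exists c.
Qed.

Lemma rees_fixed_act0 X : in_act0 (rees_quotient (fixed_subact X)).
Proof.
have [o oP] := fixed_neq0 X.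
exists (rees_pi (fixed_subact X) o); split=> [s|q]; first by rewrite -rhomP oP.
rewrite -(gen_reprK q) => qP; apply/rees_relP; right; split=> // s.
have /rees_relP := etrans (esym (rees_ractE _ _ s)) (qP s).
by case=> [|[_]].
Qed.

(** A flat precover in the whole category becomes one among the acts with
    a unique fixed point once its fixed points are identified. *)
Lemma act0_precover A P (p : rhom P A) :
  right_reversible S -> in_act0 A -> is_precover (@flat S) p ->
  exists (X : rightAct S) (q : rhom X A),
    is_precover (fun F => in_act0 F /\ flat F) q.
Proof.
move=> rev [o [_ oP]] [Pflat Pcover].
pose X := rees_quotient (fixed_subact P); pose q (x : X) : A := p (gen_repr x).
have qE x : q (rees_pi _ x) = p x.
  rewrite /q.
  have /rees_relP [->//|[fx fy]] := gen_reprK (rees_pi (fixed_subact P) x).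
  by transitivity o; [apply/esym/oP | apply: oP] => s; rewrite -rhomP ?fx ?fy.
have qP x s : q (ract x s) = ract (q x) s.
  by rewrite -(gen_reprK x) -[gen_pi _ _]/(rees_pi (fixed_subact P) _) -rhomP !qE rhomP.
exists X, (RHom qP); split.
  split; first exact: rees_fixed_act0.
  by apply: rees_flat => //; exact: fixed_stable.
move=> Y g [_ Yflat]; have [h hP] := Pcover Y g Yflat.
by exists (rhom_comp (rees_pi _) h) => y; rewrite /= qE; exact: hP.
Qed.

End UniqueFixedPoint.

Lemma flat_filtered_closed (S : monoidType) : filtered_closed (@flat S).
Proof. by move=> X I Xi c _; exact: filtered_flat. Qed.

Theorem corollary1p4 (S : monoidType)
    (S_reversible : right_reversible S)
    (S_closed : flat_closed_under_stable_rees_extensions S) :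
  (forall A : rightAct S, has_cover (@flat S) A) /\
  ((exists z : S, is_left_zero z) -> flat_cover_conjecture (@in_act0 S)).
Proof.
have precover A : exists (X : rightAct S) (p : rhom X A), is_precover (@flat S) p.
  by case: (ract_inhabited A) => a0; exact: flat_precover.
split=> [A|[z zP] A A0]; have [X [p pP]] := precover A.
  exact: cover_of_precover (@flat_filtered_closed S) pP.
have [Y [q qP]] := act0_precover zP S_reversible A0 pP.
apply: cover_of_precover qP => Z I Zi c I0 cf CZ; split.
  by apply: (act0_filtered_closed zP I0 cf) => i; case: (CZ i).
by apply: (filtered_flat cf) => i; case: (CZ i).
Qed.
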